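(* Let $\mathcal V$ and $\mathcal W$ be finite dimensional subspaces of the Hilbert space $\mathcal H$ such that $\mathcal W^\perp\oplus\mathcal V=\mathcal H$, and let $d=\dim\mathcal V=\dim\mathcal W$. Let $\mathcal F=\{f_i\}_{i\in\mathbb I_n}$ be a frame for $\mathcal W$, write $\lambda(S_{\mathcal F^\#_{\mathcal V}})=(\lambda^\#_{\mathcal V,i})_{i\in\mathbb M}$ for the eigenvalue list of the frame operator of the canonical $\mathcal V$-dual of $\mathcal F$, and let $m=2d-n$. Given $\mu=(\mu_i)_{i\in\mathbb M}\in\ell^1_+(\mathbb M)^\downarrow$, the following conditions are equivalent: 1. There exists $\mathcal G\in\mathcal D_{\mathcal V}(\mathcal F)$ such that $\lambda(S_{\mathcal G})=\mu$. 2. $\mu_i=0$ for every $i\in\mathbb M$ with $i\ge d+1$, and: (a) if $m\le 0$: $\mu_i\ge\lambda^\#_{\mathcal V,i}$ for every $i\in\mathbb I_d$; (b) if $m\ge 1$: $\mu_i\ge\lambda^\#_{\mathcal V,i}$ for every $i\in\mathbb I_d$ and $\mu_{d-m+i}\le\lambda^\#_{\mathcal V,i}$ for every $i\in\mathbb I_m$.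
   Context: $\mathcal H$ is a complex separable Hilbert space; $\mathbb I_k=\{1,\dots,k\}$; $\mathbb M=\mathbb I_p$ if $\dim\mathcal H=p<\infty$ and $\mathbb M=\mathbb N$ if $\dim\mathcal H=\infty$. $\mathcal W^\perp\oplus\mathcal V=\mathcal H$ means $\mathcal W^\perp+\mathcal V=\mathcal H$ and $\mathcal W^\perp\cap\mathcal V=\{0\}$ (not necessarily orthogonal); this is equivalent to $\mathcal W\oplus\mathcal V^\perp=\mathcal H$. $P_{\mathcal V//\mathcal W^\perp}$ is the oblique projection with range $\mathcal V$ and null space $\mathcal W^\perp$. For a finite sequence $\mathcal F=\{f_i\}_{i\in\mathbb I_n}$ in $\mathcal H$: $T_{\mathcal F}:\mathbb C^n\to\mathcal H$, $T_{\mathcal F}(a)=\sum_i a_if_i$, is the synthesis operator, $T_{\mathcal F}^*f=(\langle f,f_i\rangle)_i$, and $S_{\mathcal F}=T_{\mathcal F}T_{\mathcal F}^*$ is the frame operator. A finite sequence in $\mathcal W$ is a frame for $\mathcal W$ iff it spans $\mathcal W$. For a frame $\mathcal F$ for $\mathcal W$, $\mathcal D_{\mathcal V}(\mathcal F)$ is the set of oblique $\mathcal V$-duals of $\mathcal F$: sequences $\mathcal G=\{g_i\}_{i\in\mathbb I_n}$ in $\mathcal V$ such that $g=\sum_i\langle g,f_i\rangle g_i$ for all $g\in\mathcal V$, equivalently $T_{\mathcal G}T_{\mathcal F}^*=P_{\mathcal V//\mathcal W^\perp}$. The canonical $\mathcal V$-dual is $\mathcal F^\#_{\mathcal V}=\{P_{\mathcal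 V//\mathcal W^\perp}S_{\mathcal F}^\dagger f_i\}_{i\in\mathbb I_n}$, where $\dagger$ is the Moore-Penrose pseudo-inverse. $\ell^1_+(\mathbb M)^\downarrow$ is the set of non-increasing, non-negative, summable sequences indexed by $\mathbb M$. For a finite sequence $\mathcal G$ spanning a subspace of dimension $r$, $\lambda(S_{\mathcal G})\in\ell^1_+(\mathbb M)^\downarrow$ is the list of the $r$ positive eigenvalues of $S_{\mathcal G}$ (with multiplicity, non-increasing) followed by zeros. *)

(* Defs.v *)
From HB Require Import structures.
From mathcomp Require Import all_boot all_order all_algebra.
From mathcomp Require Import complex.
From mathcomp Require Import all_classical all_reals all_analysis.
Import Order.TTheory GRing.Theory Num.Theory.
Import numFieldNormedType.Exports.

Set Implicit Arguments.
Unset Strict Implicit.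
Unset Printing Implicit Defensive.

Local Open Scope classical_set_scope.
Local Open Scope complex_scope.
Local Open Scope ring_scope.

Definition separable_space (T : topologicalType) : Prop :=
  exists D : set T, countable D /\ dense D.

Section FiniteSequences.
Variables (K : fieldType) (E : lmodType K).

Definition synthesis n (F : 'I_n -> E) (a : 'rV[K]_n) : E :=
  \sum_(i < n) a 0 i *: F i.

Definition span_seq n (F : 'I_n -> E) : set E := range (synthesis F).

Definition lin_indep n (F : 'I_n -> E) : Prop :=
  forall a : 'rV[K]_n, synthesis F a = 0 -> a = 0.

(* U is a linear subspace of E and dim U = k. *)
Definition subspace_of_dim (U : set E) (k : nat) : Prop :=
  exists b : 'I_k -> E, lin_indep b /\ span_seq b = U.

(* Zero-based version of the index set M: {0, ..., p - 1} if dim E = p is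
   finite, and all of nat otherwise (the condition is then vacuous). *)
Definition dim_index : set nat :=
  [set i | forall p, subspace_of_dim setT p -> (i < p)%N].

Definition direct_sum (U V : set E) : Prop :=
  (forall x, exists u v, [/\ U u, V v & x = u + v]) /\ U `&` V = [set 0].

(* The projection P_{V//U}, with range V and null space U. Such a linear
   idempotent exists, and is then unique, iff U and V are subspaces with
   direct_sum U V; xget returns its first argument otherwise. *)
Definition oblique_proj (V U : set E) : E -> E :=
  xget (fun=> 0) [set P | [/\ linear P, forall x, P (P x) = P x,
                              range P = V & P @^-1` [set 0] = U]].

(* A finite sequence is a frame for W iff it is contained in W and spans W. *)
Definition is_frame n (W : set E) (F : 'I_n -> E) : Prop :=
  (forall i, W (F i)) /\ span_seq F = W.

End FiniteSequences.

Section Frames.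
(* The form dot is linear in its first argument and conjugate-linear in the
   second one. *)
Variables (R : realType) (H : lmodType R[i]) (dot : {dot H for Num.conj}).

Definition orthocomp (U : set H) : set H :=
  [set x | forall u, U u -> dot x u = 0].

Definition analysis n (F : 'I_n -> H) (f : H) : 'rV[R[i]]_n :=
  \row_(i < n) dot f (F i).

Definition frame_op n (F : 'I_n -> H) : H -> H :=
  fun f => synthesis F (analysis F f).

Definition self_adjoint (A : H -> H) : Prop :=
  forall x y, dot (A x) y = dot x (A y).

(* The four Penrose equations, which have at most one linear solution. *)
Definition is_pinv (A X : H -> H) : Prop :=
  [/\ linear X, A \o X \o A = A, X \o A \o X = X,
      self_adjoint (A \o X) & self_adjoint (X \o A)].

Definition pinv (A : H -> H) : H -> H := xget (fun=> 0) (is_pinv A).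

Definition oblique_dual n (V : set H) (F G : 'I_n -> H) : Prop :=
  (forall i, V (G i)) /\
  forall g, V g -> g = \sum_(i < n) dot g (F i) *: G i.

Definition canonical_dual n (V W : set H) (F : 'I_n -> H) : 'I_n -> H :=
  fun i => oblique_proj V (orthocomp W) (pinv (frame_op F) (F i)).

Definition eigenspace_of (A : H -> H) (c : R) : set H :=
  [set x | A x = c%:C *: x].

(* lam lists, in non-increasing order, the positive eigenvalues of S_G, each
   c > 0 occurring as many times as the dimension of its eigenspace; there are
   r = dim (span G) of them, and the remaining entries are zero. Only the
   entries with index in dim_index H matter. *)
Definition is_frame_eigenlist n (G : 'I_n -> H) (lam : nat -> R) : Prop :=
  exists r : nat,
    [/\ subspace_of_dim (span_seq G) r,
        nonincreasing_seq lam,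
        forall i, (i < r)%N -> 0 < lam i,
        forall i, (r <= i)%N -> lam i = 0 &
        forall c : R, 0 < c ->
          subspace_of_dim (eigenspace_of (frame_op G) c)
                          #|[pred i : 'I_r | lam i == c]| ].

Definition frame_eigenlist n (G : 'I_n -> H) : nat -> R :=
  xget (fun=> 0) (is_frame_eigenlist G).

End Frames.

(* mu, restricted to M, belongs to l^1_+(M) and is non-increasing. *)
Definition l1_plus_down (R : realType) (M : set nat) (mu : nat -> R) : Prop :=
  [/\ forall i, M i -> 0 <= mu i,
      forall i j, M i -> M j -> (i <= j)%N -> mu j <= mu i &
      summable M (EFin \o mu)].

(* Main.v *)
(** In coordinates with respect to an orthonormal basis (e_k) of V, a sequence
    G in V is an n x d matrix M, its frame operator restricted to V is M^* M,
    and G is an oblique dual of F iff A M = 1, where A_ki = <e_k, f_i>. The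
    matrix A has full row rank d, the canonical dual is M0 = A^* (A A^* )^-1,
    and the duals are the M0 + Z with A Z = 0, for which
      M^* M = M0^* M0 + Z^* Z.
    As Z^* Z runs over all positive semidefinite matrices of rank at most
    n - d, the question is which spectra such perturbations of M0^* M0 have.
    Necessity is Courant-Fischer; for sufficiency, add n - d rank-one matrices
    one at a time, each time with interlacing spectra. *)
Require Import Defs.
From HB Require Import structures.
From mathcomp Require Import all_boot all_order all_algebra.
From mathcomp Require Import perm complex ring zify.
From mathcomp Require Import all_classical all_reals all_analysis.
Import Order.TTheory GRing.Theory Num.Theory.
Import numFieldNormedType.Exports.

Set Implicit Arguments.
Unset Strict Implicit.
Unset Printing Implicit Defensive.

Local Open Scope classical_set_scope.
Local Open Scope complex_scope.
Local Open Scope ring_scope.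
Local Open Scope sesquilinear_scope.

(** * Interlacing and rank-one perturbations of diagonal matrices *)

Section Interlacing.
Variable R : realFieldType.

Definition prodX (d : nat) (a : nat -> R) : {poly R} :=
  \prod_(i < d) ('X - (a i)%:P).

Definition prodX_but (d : nat) (a : nat -> R) (j : nat) : {poly R} :=
  \prod_(i < d | (i : nat) != j) ('X - (a i)%:P).

Lemma prodXS d a : prodX d.+1 a = prodX d a * ('X - (a d)%:P).
Proof. by rewrite /prodX big_ord_recr. Qed.

Lemma prodX_butS d a j : (j < d)%N ->
  prodX_but d.+1 a j = prodX_but d a j * ('X - (a d)%:P).
Proof.
move=> jd; rewrite /prodX_but big_mkcond big_ord_recr /= gtn_eqF//.
by rewrite -big_mkcond.
Qed.

Lemma prodX_but_last d a : prodX_but d.+1 a d = prodX d a.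
Proof.
rewrite /prodX_but /prodX big_mkcond big_ord_recr /= eqxx mulr1 -big_mkcond.
by apply: eq_bigl => i; rewrite neq_ltn ltn_ord.
Qed.

Lemma prodX_butE d a j : (j < d)%N ->
  prodX_but d a j * ('X - (a j)%:P) = prodX d a.
Proof.
by move=> jd; rewrite /prodX (bigD1 (Ordinal jd)) //= mulrC.
Qed.

(* Induction on d, the smallest pair (lam d, mu d) being added last: with
   s = (mu d - lam d) / (lam j - lam d) (which is 0 when lam j = lam d, as then
   also mu d = lam d), the product over i < d, i != j is re-expanded by
   'X - mu d = (1 - s) ('X - lam d) + s ('X - lam j). *)
Lemma interlacing_cone d (lam mu : nat -> R) :
    (forall i, (i < d)%N -> lam i <= mu i) ->
    (forall i j, (i < j)%N -> (j < d)%N -> mu j <= lam i) ->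
  exists2 c : nat -> R, forall i, (i < d)%N -> 0 <= c i &
    prodX d lam - prodX d mu = \sum_(j < d) c j *: prodX_but d lam j.
Proof.
elim: d => [|d IHd] le_lam_mu le_mu_lam.
  by exists (fun=> 0) => //; rewrite /prodX !big_ord0 subrr.
have [i id|i j ij jd|c c_ge0 cE] := IHd.
- by apply: le_lam_mu; apply: ltnW.
- by apply: le_mu_lam => //; apply: ltnW.
set a := lam d; set b := mu d.
have le_ab : a <= b by apply: le_lam_mu.
have le_b j : (j < d)%N -> b <= lam j by move=> jd; apply: le_mu_lam.
have [s [s_ge0 s_le1 sE]] : exists s : nat -> R,
    [/\ forall j, (j < d)%N -> 0 <= s j, forall j, (j < d)%N -> s j <= 1 &
        forall j, (j < d)%N -> s j * (lam j - a) = b - a].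
  exists (fun j => (b - a) / (lam j - a)).
  split=> j /le_b h.
  - by rewrite divr_ge0// subr_ge0// (le_trans le_ab).
  - have [->|ne] := eqVneq (lam j) a; first by rewrite subrr invr0 mulr0.
    rewrite ler_pdivrMr ?mul1r ?lerB// subr_gt0 lt_def ne.
    by rewrite (le_trans le_ab).
  - have [e|ne] := eqVneq (lam j) a; last by rewrite divfK// subr_eq0.
    rewrite e subrr mulr0; apply/esym/eqP; rewrite subr_eq0 eq_le le_ab.
    by rewrite -[X in _ <= X]e h.
(* The shares [c j * s j] split off multiply [prodX d lam], which is the new basis polynomial of
   index [d]; there they join [b - a], which comes from exchanging the last factor. *)
pose c' j := if (j < d)%N then c j * (1 - s j)
             else (b - a) + \sum_(k < d) c k * s k.
exists c' => [i|].
  rewrite /c' ltnS leq_eqVlt => /orP[/eqP->|id].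
    rewrite ltnn addr_ge0 ?subr_ge0// sumr_ge0// => k _.
    by rewrite mulr_ge0 ?c_ge0 ?s_ge0.
  by rewrite id mulr_ge0 ?c_ge0 ?subr_ge0 ?s_le1.
rewrite big_ord_recr /= prodX_but_last !prodXS.
have -> : prodX d mu = prodX d lam - \sum_(j < d) c j *: prodX_but d lam j.
  by rewrite -cE subKr.
rewrite {2}/c' ltnn -/a -/b.
rewrite [X in _ = X + _](_ : _ = \sum_(j < d) c j *: (prodX_but d lam j *
    ('X - b%:P)) - \sum_(j < d) (c j * s j) *: prodX d lam); last first.
  rewrite -sumrB; apply: eq_bigr => j _; rewrite /c' ltn_ord prodX_butS//.
  rewrite -(prodX_butE lam (ltn_ord j)) -/a.
  rewrite -!mul_polyC !(rmorphM, rmorphB, rmorph1) /=.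
  have : ((s j * (lam j - a))%:P = (b - a)%:P :> {poly R}) by rewrite sE.
  rewrite rmorphM !rmorphB /=.
  set P := prodX_but _ _ _; move: (s j)%:P (lam j)%:P (c j)%:P a%:P b%:P P.
  move=> S L D A B P e; have -> : B = S * (L - A) + A by rewrite e subrK.
  by ring.
rewrite scalerDl scaler_suml mulrBl mulr_suml.
under [X in _ = X - _ + _]eq_bigr do rewrite scalerAl.
rewrite -!mul_polyC rmorphB /=.
ring.
Qed.

End Interlacing.

(** Matrix determinant lemma without denominators, so that it applies to entries ['X - lam i] over a
    polynomial ring: the products with one factor omitted, collected in [y], replace the inverse of
    [diag_mx x] up to the factor [p]. *)
Lemma det_diag_sub_rank1 (P : idomainType) d (x : 'rV[P]_d)
    (u : 'cV[P]_d) (w : 'rV[P]_d) : (forall i, x 0 i != 0) ->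
  \det (diag_mx x - u *m w) = \prod_i x 0 i -
    \sum_j (u j 0 * w 0 j) * \prod_(i | i != j) x 0 i.
Proof.
move=> x_neq0; set p := \prod_i x 0 i.
pose y : 'rV[P]_d := \row_j \prod_(i | i != j) x 0 i.
have p_neq0 : p != 0 by apply/prodf_neq0 => k _; apply: x_neq0.
have xyE : diag_mx x *m diag_mx y = p%:M.
  rewrite mulmx_diag -diag_const_mx; congr diag_mx; apply/rowP => j.
  by rewrite !mxE /p [RHS](bigD1 j).
have y_neq0 : \det (diag_mx y) != 0.
  rewrite det_diag; apply/prodf_neq0 => j _; rewrite mxE.
  by apply/prodf_neq0 => k _; apply: x_neq0.
(* Both sides are the Schur complements of the same bordered matrix. *)
pose M := block_mx (diag_mx x) u w (1%:M : 'M[P]_1).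
have M1 : \det M = \det (diag_mx x - u *m w).
  have /(congr1 determinant) : M *m block_mx 1%:M 0 (- w) 1%:M =
      block_mx (diag_mx x - u *m w) u 0 1%:M.
    rewrite mulmx_block !mulmx1 !mulmx0 !mul1mx !add0r !mulmxN.
    by rewrite subrr.
  by rewrite det_mulmx det_lblock det_ublock !det1 !mulr1.
have M2 : \det M * (\det (diag_mx y) * p) =
          p ^+ d * (p - (w *m diag_mx y *m u) 0 0).
  have /(congr1 determinant) : M *m block_mx (diag_mx y) (- (diag_mx y *m u))
      0 p%:M = block_mx p%:M 0 (w *m diag_mx y) (p%:M - w *m diag_mx y *m u).
    rewrite mulmx_block xyE !mulmx0 !addr0 !mulmxN !mulmxA xyE.
    by rewrite !mul_scalar_mx mul_mx_scalar scale1r addNr addrC.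
  rewrite det_mulmx det_ublock det_lblock !det_scalar expr1 => ->.
  by rewrite det_mx11 !mxE eqxx mulr1n.
have yE : p ^+ d = p * \det (diag_mx y).
  by rewrite -det_scalar -xyE det_mulmx [\det (diag_mx x)]det_diag.
apply: (mulIf (mulf_neq0 y_neq0 p_neq0)); rewrite -M1 M2 yE.
rewrite [X in p - X](_ : _ = \sum_j (u j 0 * w 0 j) *
    \prod_(i | i != j) x 0 i); first by ring.
rewrite mxE; apply: eq_bigr => j _; rewrite mul_mx_diag !mxE.
by ring.
Qed.

(** * Spectra of positive semidefinite matrices *)

Section Adjoint.
Variable C : numClosedFieldType.

Lemma adjmxM m n p (A : 'M[C]_(m, n)) (B : 'M[C]_(n, p)) :
  (A *m B)^t* = B^t* *m A^t*.
Proof. by rewrite trmx_mul map_mxM. Qed.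

Lemma adjmxD m n (A B : 'M[C]_(m, n)) : (A + B)^t* = A^t* + B^t*.
Proof. by rewrite linearD map_mxD. Qed.

Lemma adjmx_col m1 m2 n (A : 'M[C]_(m1, n)) (B : 'M[C]_(m2, n)) :
  (col_mx A B)^t* = row_mx (A^t* ) (B^t* ).
Proof. by rewrite tr_col_mx map_row_mx. Qed.

Lemma adjmx1 n : (1%:M : 'M[C]_n)^t* = 1%:M.
Proof. by rewrite trmx1 map_mx1. Qed.

Lemma mulmx_adj_ge0 n (x : 'rV[C]_n) : 0 <= (x *m x^t*) 0 0.
Proof. by rewrite -dotmxE dnorm_ge0. Qed.

Lemma mulmx_adj_gt0 n (x : 'rV[C]_n) : (0 < (x *m x^t*) 0 0) = (x != 0).
Proof. by rewrite -dotmxE dnorm_gt0. Qed.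

Lemma unitarymx_adjmul n {U : 'M[C]_n} : U \is unitarymx -> U^t* *m U = 1%:M.
Proof. by move=> Uu; rewrite -invmx_unitary// mulVmx// unitarymx_unit. Qed.

Lemma mulmx_adjE n (x y : 'rV[C]_n) :
  (x *m y^t*) 0 0 = \sum_j x 0 j * (y 0 j)^*.
Proof. by rewrite mxE; apply: eq_bigr => j _; rewrite !mxE. Qed.

Lemma normmx_unitary n (U : 'M[C]_n) (x : 'rV[C]_n) : U \is unitarymx ->
  (x *m x^t*) 0 0 = \sum_j `|(x *m U^t*) 0 j| ^+ 2.
Proof.
move=> Uu; transitivity (((x *m U^t*) *m (x *m U^t*)^t*) 0 0).
  rewrite adjmxM trmxCK mulmxA -[x *m _ *m _]mulmxA.
  by rewrite unitarymx_adjmul// mulmx1.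
by rewrite mulmx_adjE; apply: eq_bigr => j _; rewrite normCK.
Qed.

End Adjoint.

Section Spectrum.
Variable R : rcfType.
Local Notation C := R[i].

Definition diagC d (lam : nat -> R) : 'M[C]_d :=
  diag_mx (\row_(i < d) (lam i)%:C).

(** Zeros past index [d] and monotonicity force [lam] to be nonnegative, so this describes positive
    semidefinite matrices, and shifted indices such as [i + k] need no bound. Matrices act on row
    vectors, so the rows of [U] are the eigenvectors. *)
Definition has_spectrum d (A : 'M[C]_d) (lam : nat -> R) : Prop :=
  [/\ forall i j, (i <= j)%N -> lam j <= lam i,
      forall i, (d <= i)%N -> lam i = 0 &
      exists2 U : 'M[C]_d, U \is unitarymx & A = U^t* *m diagC d lam *m U].

Lemma eq_has_spectrum d (A : 'M[C]_d) lam lam' :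
  lam =1 lam' -> has_spectrum A lam -> has_spectrum A lam'.
Proof.
move=> e [ni z [U Uu ->]]; split=> [i j|i|].
- by rewrite -!e; apply: ni.
- by rewrite -e; apply: z.
exists U; first exact: Uu.
congr (_ *m diag_mx _ *m _).
by apply/rowP => i; rewrite !mxE e.
Qed.

Lemma has_spectrum_ge0 d (A : 'M[C]_d) lam i : has_spectrum A lam -> 0 <= lam i.
Proof.
by move=> [ni z _]; rewrite -(z (i + d)%N (leq_addl _ _)) ni ?leq_addr.
Qed.

Lemma conj_realC (x : R) : Num.conj x%:C = x%:C.
Proof. by apply/conj_Creal; rewrite complex_real. Qed.

Lemma diagC_adj d lam : (diagC d lam)^t* = diagC d lam.
Proof.
rewrite /diagC tr_diag_mx map_diag_mx; congr diag_mx.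
by apply/rowP => i; rewrite !mxE; apply: conj_realC.
Qed.

Lemma quad_spectrum d (U : 'M[C]_d) lam (x : 'rV[C]_d) :
  (x *m (U^t* *m diagC d lam *m U) *m x^t*) 0 0 =
  \sum_(j < d) (lam j)%:C * `|(x *m U^t*) 0 j| ^+ 2.
Proof.
transitivity (((x *m U^t* *m diagC d lam) *m (x *m U^t*)^t*) 0 0).
  by rewrite adjmxM trmxCK !mulmxA.
rewrite mulmx_adjE; apply: eq_bigr => j _.
by rewrite mul_mx_diag !mxE normCK -mulrA mulrCA.
Qed.

Lemma has_spectrum_adj d (A : 'M[C]_d) lam : has_spectrum A lam -> A^t* = A.
Proof.
by move=> [_ _ [U _ ->]]; rewrite !adjmxM trmxCK diagC_adj mulmxA.
Qed.

Lemma has_spectrum_psd d (A : 'M[C]_d) lam (x : 'rV[C]_d) :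
  has_spectrum A lam -> 0 <= (x *m A *m x^t*) 0 0.
Proof.
move=> h; have [_ _ [U _ AE]] := h; rewrite AE quad_spectrum.
rewrite sumr_ge0// => j _.
by rewrite mulr_ge0 ?exprn_ge0// lecR (has_spectrum_ge0 _ h).
Qed.

(** The spectral theorem yields unordered complex eigenvalues. They are real because [A] is
    Hermitian, and nonnegative by evaluating the form at the rows of [P]; sorting them permutes
    these rows. *)
Lemma psd_has_spectrum d (A : 'M[C]_d) : A^t* = A ->
  (forall x : 'rV[C]_d, 0 <= (x *m A *m x^t*) 0 0) ->
  exists lam, has_spectrum A lam.
Proof.
move=> Aadj Apsd.
have Aherm : A \is hermsymmx.
  by apply/is_hermitianmxP; rewrite expr0 scale1r Aadj.
have /hermitian_normalmx/orthomx_spectralP := Aherm.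
set P := spectralmx A; set sp := spectral_diag A.
have Pu : P \is unitarymx := spectral_unitarymx A.
rewrite invmx_unitary// => AE.
have spE i : (complex.Re (sp 0 i : C))%:C = sp 0 i.
  apply: RRe_real; have := hermitian_spectral_diag_real Aherm.
  by move/mxOverP; apply.
have sp_ge0 i : 0 <= complex.Re (sp 0 i : C).
  rewrite -lecR spE; have := Apsd (row i P).
  suff -> : (row i P *m A *m (row i P)^t*) 0 0 = sp 0 i by [].
  have PA : P *m A = diag_mx sp *m P.
    by rewrite AE !mulmxA (unitarymxP Pu) mul1mx.
  rewrite -row_mul PA row_mul row_diag_mx -!scalemxAl -rowE mxE.
  rewrite -[RHS]mulr1; congr (_ * _).
  have /matrixP/(_ i i) := unitarymxP Pu; rewrite !mxE eqxx => e.
  by rewrite -[RHS]e; apply: eq_bigr => j _; rewrite !mxE.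
pose s := [tuple complex.Re (sp 0 i : C) | i < d].
pose t := sort_tuple >=%O s.
have /tuple_permP[p /val_inj tE] : perm_eq t s by rewrite perm_sort.
have nth_t (i : 'I_d) : t`_i = complex.Re (sp 0 (p i) : C).
  by rewrite -tnth_nth tE !tnth_mktuple.
have t_sorted : sorted >=%O t by apply: sort_sorted => x y; apply: le_total.
have t_out i : (d <= i)%N -> t`_i = 0.
  by move=> di; rewrite nth_default// size_tuple.
exists (fun i => t`_i); split=> //.
  move=> i j ij; have [dj|jd] := leqP d j.
    rewrite t_out//; have [di|id] := leqP d i; first by rewrite t_out.
    by rewrite (nth_t (Ordinal id)).
  have := @sorted_leq_nth _ >=%O ge_trans ge_refl 0 _ t_sorted i j.
  by rewrite !inE size_tuple; apply => //; apply: leq_ltn_trans jd.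
pose U := \matrix_(i, j) P (p i) j.
have UE : U = row_perm p P by apply/matrixP => i j; rewrite !mxE.
exists U.
  apply/unitarymxP/matrixP => i j.
  have /matrixP/(_ (p i) (p j)) := unitarymxP Pu; rewrite !mxE.
  rewrite (inj_eq perm_inj) => <-; apply: eq_bigr => k _.
  by rewrite !mxE.
rewrite AE /diagC; apply/matrixP => i j.
rewrite !mul_mx_diag !mxE (reindex_inj (@perm_inj _ p)) /=.
by apply: eq_bigr => k _; rewrite !mxE nth_t spE.
Qed.

Lemma char_poly_conj d (V A U : 'M[C]_d) : V *m U = 1%:M ->
  char_poly (V *m A *m U) = char_poly A.
Proof.
move=> VU; rewrite /char_poly /char_poly_mx.
have e : map_mx polyC V *m map_mx polyC U = 1%:M by rewrite -map_mxM VU map_mx1.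
rewrite !map_mxM -[X in X - _]mul1mx -e.
have -> : map_mx polyC V *m map_mx polyC U *m 'X%:M =
    map_mx polyC V *m 'X%:M *m map_mx polyC U.
  by rewrite -!mulmxA scalar_mxC.
by rewrite -mulmxBl -mulmxBr !det_mulmx mulrAC -det_mulmx e det1 mul1r.
Qed.

Lemma has_spectrum_char_poly d (A : 'M[C]_d) lam : has_spectrum A lam ->
  char_poly A = map_poly (real_complex R) (prodX d lam).
Proof.
move=> [_ _ [U Uu ->]]; rewrite char_poly_conj ?unitarymx_adjmul//.
rewrite char_poly_trig ?diag_mx_is_trig// /prodX rmorph_prod /=.
by apply: eq_bigr => i _; rewrite map_polyXsubC !mxE eqxx mulr1n.
Qed.

Lemma perm_mkseq_nonincreasing d (a b : nat -> R) :
  (forall i j, (i <= j)%N -> a j <= a i) ->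
  (forall i j, (i <= j)%N -> b j <= b i) ->
  perm_eq (mkseq a d) (mkseq b d) -> forall i, (i < d)%N -> a i = b i.
Proof.
have srt (c : nat -> R) : (forall i j, (i <= j)%N -> c j <= c i) ->
    sorted >=%O (mkseq c d).
  move=> ni; apply/(path.sortedP (0 : R)) => i; rewrite size_mkseq => id.
  by rewrite !nth_mkseq ?(ltnW id)//; apply: ni.
move=> /srt sa /srt sb /(sorted_eq ge_trans ge_anti sa sb) e i id.
by rewrite -(nth_mkseq 0 a id) e nth_mkseq.
Qed.

(** A polynomial determines the multiset of its roots, and a sorted list is determined by its
    multiset. Identifying a spectrum thus reduces to computing a characteristic polynomial. *)
Lemma char_poly_spectrum_uniq d (A : 'M[C]_d) lam mu : has_spectrum A lam ->
  (forall i j, (i <= j)%N -> mu j <= mu i) ->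
  (forall i, (d <= i)%N -> mu i = 0) ->
  char_poly A = map_poly (real_complex R) (prodX d mu) -> lam =1 mu.
Proof.
move=> h mu_ni mu0; rewrite (has_spectrum_char_poly h).
have [lam_ni lam0 _] := h.
move=> /(map_inj_poly (@complexI R) (rmorph0 _)).
have pE (a : nat -> R) : prodX d a = \prod_(x <- mkseq a d) ('X - x%:P).
  by rewrite big_map -[X in iota 0 X](subn0 d) big_mkord.
rewrite !pE => /prod_XsubC_eq /(perm_mkseq_nonincreasing lam_ni mu_ni) e i.
by have [di|/e//] := leqP d i; rewrite lam0 ?mu0.
Qed.

End Spectrum.

(** * Perturbation of spectra by Gram matrices *)

Section Perturbation.
Variable R : rcfType.
Local Notation C := R[i].

Lemma gram_psd m d (Z : 'M[C]_(m, d)) (x : 'rV[C]_d) :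
  0 <= (x *m (Z^t* *m Z) *m x^t*) 0 0.
Proof.
have -> : x *m (Z^t* *m Z) *m x^t* = (x *m Z^t*) *m (x *m Z^t*)^t*.
  by rewrite adjmxM trmxCK !mulmxA.
exact: mulmx_adj_ge0.
Qed.

Lemma gram_has_spectrum m d (Z : 'M[C]_(m, d)) :
  exists mu, has_spectrum (Z^t* *m Z) mu.
Proof.
by apply: psd_has_spectrum => [|x]; rewrite ?gram_psd// adjmxM trmxCK.
Qed.

Lemma add_gram_has_spectrum m d (B : 'M[C]_d) lam (Z : 'M[C]_(m, d)) :
  has_spectrum B lam -> exists mu, has_spectrum (B + Z^t* *m Z) mu.
Proof.
move=> h; apply: psd_has_spectrum => [|x].
  by rewrite adjmxD adjmxM trmxCK (has_spectrum_adj h).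
by rewrite mulmxDr mulmxDl mxE addr_ge0 ?(has_spectrum_psd _ h) ?gram_psd.
Qed.

(** The determinant formula with diagonal entries ['X - lam i] gives exactly the kind of expansion
    provided by [interlacing_cone], the coefficients being the squared moduli of the entries of
    [w]. *)
Lemma char_poly_diag_rank1 d (lam c : nat -> R) (w : 'rV[C]_d) :
  (forall j : 'I_d, `|w 0 j| ^+ 2 = (c j)%:C) ->
  char_poly (diagC d lam + w^t* *m w) = map_poly (real_complex R)
    (prodX d lam - \sum_(j < d) c j *: prodX_but d lam j).
Proof.
move=> wE; pose x : 'rV[{poly C}]_d := \row_i ('X - (lam i)%:C%:P).
have -> : char_poly (diagC d lam + w^t* *m w) =
    \det (diag_mx x - map_mx polyC (w^t* ) *m map_mx polyC w).
  rewrite /char_poly /char_poly_mx map_mxD map_mxM opprD addrA.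
  congr (\det (_ - _)); apply/matrixP => i j; rewrite !mxE.
  by case: (i == j); rewrite ?mulr1n ?mulr0n ?subr0 ?polyC0 ?subr0.
rewrite det_diag_sub_rank1 => [|i]; last by rewrite mxE polyXsubC_eq0.
rewrite rmorphB rmorph_sum /= /prodX rmorph_prod /=; congr (_ - _).
  by apply: eq_bigr => i _; rewrite map_polyXsubC mxE.
apply: eq_bigr => j _; rewrite !mxE -polyCM.
rewrite [X in X%:P](_ : _ = (c j)%:C); last first.
  by rewrite -wE normCK mulrC.
rewrite map_polyZ /= -mul_polyC /prodX_but rmorph_prod /=; congr (_ * _).
by apply: eq_big => // i _; rewrite map_polyXsubC mxE.
Qed.

(** Converse of interlacing for rank-one updates. *)
Lemma rank1_perturbation d (B : 'M[C]_d) lam mu :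
    has_spectrum B lam ->
    (forall i j, (i <= j)%N -> mu j <= mu i) ->
    (forall i, (d <= i)%N -> mu i = 0) ->
    (forall i, lam i <= mu i) -> (forall i, mu i.+1 <= lam i) ->
  exists v : 'rV[C]_d, has_spectrum (B + v^t* *m v) mu.
Proof.
move=> Bh mu_ni mu0 le_lam_mu le_mu_lam.
have [||c c_ge0 cE] := @interlacing_cone R d lam mu; first by [].
  by move=> i j ij _; apply: le_trans (le_mu_lam i); apply: mu_ni.
have [_ _ [U Uu BE]] := Bh.
(* In the eigenbasis of [B], these entries turn the characteristic polynomial of the sum into
   [prodX d lam - (prodX d lam - prodX d mu)]. *)
pose w : 'rV[C]_d := \row_j (Num.sqrt (c j))%:C.
exists (w *m U); have [mu' h] := add_gram_has_spectrum (w *m U) Bh.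
apply: eq_has_spectrum (h); apply: char_poly_spectrum_uniq h mu_ni mu0 _.
have -> : B + (w *m U)^t* *m (w *m U) =
    U^t* *m (diagC d lam + w^t* *m w) *m U.
  by rewrite BE adjmxM mulmxDr mulmxDl !mulmxA.
rewrite char_poly_conj ?unitarymx_adjmul// (char_poly_diag_rank1 _ (c := c)).
  by rewrite -cE subKr.
move=> j; rewrite mxE ger0_norm ?lecR ?sqrtr_ge0//.
by rewrite -rmorphXn /= sqr_sqrtr ?c_ge0.
Qed.

Lemma rank_perturbation k d (B : 'M[C]_d) lam mu :
    has_spectrum B lam ->
    (forall i j, (i <= j)%N -> mu j <= mu i) ->
    (forall i, (d <= i)%N -> mu i = 0) ->
    (forall i, lam i <= mu i) -> (forall i, mu (i + k)%N <= lam i) ->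
  exists Z : 'M[C]_(k, d), has_spectrum (B + Z^t* *m Z) mu.
Proof.
elim: k lam mu B => [|k IHk] lam mu B Bh mu_ni mu0 le_lam_mu le_mu_lam.
  exists 0; rewrite mulmx0 addr0; apply: eq_has_spectrum Bh => i.
  by apply/eqP; rewrite eq_le le_lam_mu -[X in mu X]addn0 le_mu_lam.
have [lam_ni lam0 _] := Bh.
(* nu is within k steps of lam, and one step below mu. *)
pose nu i := Num.max (lam i) (mu i.+1).
have nu_ni i j : (i <= j)%N -> nu j <= nu i.
  move=> ij; rewrite ge_max !le_max lam_ni//=.
  by rewrite [mu j.+1 <= mu _]mu_ni ?ltnS// orbT.
have nu0 i : (d <= i)%N -> nu i = 0.
  by move=> di; rewrite /nu lam0// mu0 ?maxxx// ltnW.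
have [|i|Z Zh] := IHk lam nu B Bh nu_ni nu0.
- by move=> i; rewrite le_max lexx.
- rewrite ge_max lam_ni ?leq_addr//=; apply: le_trans (le_mu_lam i).
  by rewrite addnS.
have [||v vh] := rank1_perturbation Zh mu_ni mu0.
- by move=> i; rewrite ge_max le_lam_mu mu_ni.
- by move=> i; rewrite le_max lexx orbT.
(* Stacking [v] on [Z] adds their Gram matrices. *)
suff h : has_spectrum (B + (col_mx v Z)^t* *m col_mx v Z) mu.
  by exists (col_mx v Z).
by rewrite adjmx_col mul_row_col [X in B + X]addrC addrA.
Qed.

Lemma mxrank_cap_ge m1 m2 n (A : 'M[C]_(m1, n)) (B : 'M[C]_(m2, n)) :
  (\rank A + \rank B <= \rank (A :&: B)%MS + n)%N.
Proof.
by rewrite -mxrank_sum_cap addnC leq_add2l rank_leq_col.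
Qed.

(** The form of [A] is dominated by that of [B] only on a subspace of codimension at most [k], which
    costs a shift by [k]. It serves with [K] the whole space and with [K] the kernel of a
    perturbation. *)
Lemma weyl d k (A B : 'M[C]_d) a b m (K : 'M[C]_(m, d)) :
    has_spectrum A a -> has_spectrum B b -> (d <= \rank K + k)%N ->
    (forall x : 'rV[C]_d, (x <= K)%MS ->
       (x *m A *m x^t*) 0 0 <= (x *m B *m x^t*) 0 0) ->
  forall i, a (i + k)%N <= b i.
Proof.
move=> Ah Bh rkK le_AB i; have [a_ni a0 [U Uu AE]] := Ah.
have [b_ni b0 [V Vu BE]] := Bh.
have [dik|ikd] := leqP d (i + k); first by rewrite a0 ?(has_spectrum_ge0 _ Bh).
(* Dimension count: some x in K is a combination of eigenvectors of A with
   indices <= i + k, and of eigenvectors of B with indices >= i. *)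
pose S1 : 'M[C]_d := pid_mx (i + k).+1 *m U.
pose S2 : 'M[C]_d := copid_mx i *m V.
have rk1 : \rank S1 = (i + k).+1.
  by rewrite mxrankMfree ?rank_pid_mx// row_free_unit unitarymx_unit.
have rk2 : \rank S2 = (d - i)%N.
  by rewrite mxrankMfree ?rank_copid_mx ?row_free_unit ?unitarymx_unit//; lia.
(* The three dimensions sum to at least [(i + k + 1) + (d - i) + (d - k) = 2 d + 1]. *)
have : (S1 :&: S2 :&: K)%MS != 0.
  rewrite -mxrank_eq0; have := mxrank_cap_ge S1 S2.
  have := mxrank_cap_ge (S1 :&: S2)%MS K; lia.
case/rowV0Pn => x; rewrite !sub_capmx => /andP[/andP[/submxP[y1 x1E]
  /submxP[y2 x2E]] xK] x_neq0.
have x_gt0 : 0 < (x *m x^t*) 0 0 by rewrite mulmx_adj_gt0.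
have := le_AB x xK; rewrite {1}AE BE !quad_spectrum => le_quad.
(* At this [x], the form of [A] is at least [a (i + k)] times the squared norm, and the form of [B]
   at most [b i] times it. *)
rewrite -lecR -(ler_pM2r x_gt0).
rewrite {1}(normmx_unitary x Uu) (normmx_unitary x Vu) !mulr_sumr.
apply: le_trans (le_trans le_quad _); apply: ler_sum => j _.
  have [ij|ij] := leqP j (i + k)%N.
    by rewrite ler_wpM2r ?exprn_ge0// lecR a_ni.
  suff -> : (x *m U^t*) 0 j = 0 by rewrite normr0 expr0n !mulr0.
  rewrite x1E /S1 mulmxA mulmxtVK// mxE big1// => l _.
  rewrite mxE; case: eqP => [->|_]; rewrite ?mulr0//.
  by rewrite ltnNge ij mulr0.
have [ij|ij] := leqP i j.
  by rewrite ler_wpM2r ?exprn_ge0// lecR b_ni.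
suff -> : (x *m V^t*) 0 j = 0 by rewrite normr0 expr0n !mulr0.
rewrite x2E /S2 mulmxA mulmxtVK// mxE big1// => l _.
rewrite !mxE -val_eqE; case: eqP => [->|_]; last by rewrite subr0 mulr0.
by rewrite ij subrr mulr0.
Qed.

End Perturbation.

(** * Right inverses of a matrix and their Gram spectra *)

Section MatrixDuals.
Variable R : rcfType.
Local Notation C := R[i].

(** If [v] kills the Gram matrix, then [v *m A] has norm zero. *)
Lemma gram_unitmx m n (A : 'M[C]_(m, n)) :
  row_free A -> A *m A^t* \in unitmx.
Proof.
move=> Afree; rewrite -row_free_unit; apply: inj_row_free => v vAA.
apply/eqP; rewrite -(mulmx_free_eq0 _ Afree); apply/negPn.
rewrite -mulmx_adj_gt0 adjmxM mulmxA -[v *m A *m _]mulmxA vAA mul0mx mxE.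
by rewrite ltxx.
Qed.

Lemma has_spectrum_gt0 d (A : 'M[C]_d) lam i : has_spectrum A lam ->
  A \in unitmx -> (i < d)%N -> 0 < lam i.
Proof.
move=> h; rewrite lt_def (has_spectrum_ge0 _ h) andbT.
have [_ _ [U Uu ->]] := h; rewrite unitmxE !det_mulmx !unitfE.
rewrite !mulf_eq0 !negb_or.
case/andP => /andP[_]; rewrite det_diag => /prodf_neq0 D_neq0 _ id.
by have := D_neq0 (Ordinal id) isT; rewrite mxE; apply: contraNneq => ->.
Qed.

(** [E] is an inverse square root of [N], up to a unitary factor on the left. For [N] the Gram
    matrix of a basis, its rows are the coordinates of an orthonormal basis. *)
Lemma orthonormalize_gram d (N : 'M[C]_d) lam : has_spectrum N lam ->
  N \in unitmx -> exists E : 'M[C]_d, E *m N *m E^t* = 1%:M.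
Proof.
move=> h Nu; have [_ _ [U Uu NE]] := h.
pose s i := (Num.sqrt (lam i))^-1.
exists (diagC d s *m U); rewrite NE adjmxM diagC_adj !mulmxA.
rewrite !mulmxtVK// !mulmx_diag -diag_const_mx; congr diag_mx.
apply/rowP => i; rewrite !mxE -!rmorphM /= /s.
have l_gt0 := has_spectrum_gt0 h Nu (ltn_ord i).
rewrite -[X in _ * X * _](sqr_sqrtr (ltW l_gt0)) expr2 mulKf ?mulfV//.
  by rewrite gt_eqF// sqrtr_gt0.
by rewrite gt_eqF// sqrtr_gt0.
Qed.

Lemma dual_spectrum d n (A : 'M[C]_(d, n)) (lam mu : nat -> R) :
    let G0 := A^t* *m invmx (A *m A^t* ) in
    row_free A -> has_spectrum (G0^t* *m G0) lam ->
    (forall i j, (i <= j)%N -> mu j <= mu i) ->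
    (forall i, (d <= i)%N -> mu i = 0) ->
  (exists2 G : 'M[C]_(n, d), A *m G = 1%:M & has_spectrum (G^t* *m G) mu) <->
  (forall i, lam i <= mu i) /\ (forall i, mu (i + (n - d))%N <= lam i).
Proof.
move=> G0 Afree G0h mu_ni mu0.
have Nu := gram_unitmx Afree.
have AG0 : A *m G0 = 1%:M by rewrite mulmxA mulmxV.
(* The columns of [G0] lie in the range of the adjoint of [A], hence are orthogonal to the kernel of
   [A], where the columns of [Z] lie. *)
have cross (Z : 'M[C]_(n, d)) : A *m Z = 0 ->
    (G0 + Z)^t* *m (G0 + Z) = G0^t* *m G0 + Z^t* *m Z.
  move=> AZ; rewrite adjmxD mulmxDl !mulmxDr.
  have G0Z : G0^t* *m Z = 0 by rewrite adjmxM trmxCK -mulmxA AZ mulmx0.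
  have ZG0 : Z^t* *m G0 = 0.
    by rewrite -[LHS]trmxCK adjmxM trmxCK G0Z trmx0 map_mx0.
  by rewrite G0Z ZG0 addr0 add0r.
split=> [[G AG Gh]|[le_lam_mu le_mu_lam]].
  pose Z := G - G0.
  have AZ : A *m Z = 0 by rewrite mulmxBr AG AG0 subrr.
  have GE : G = G0 + Z by rewrite addrC subrK.
  have quadE (x : 'rV[C]_d) : (x *m (G^t* *m G) *m x^t*) 0 0 =
      (x *m (G0^t* *m G0) *m x^t*) 0 0 + ((x *m Z^t*) *m (x *m Z^t*)^t*) 0 0.
    rewrite GE cross// mulmxDr mulmxDl mxE; congr (_ + _).
    by rewrite adjmxM trmxCK !mulmxA.
  split.
    move=> i; rewrite -[i in lam i]addn0.
    apply: (@weyl _ _ _ _ _ _ _ _ 1%:M G0h Gh); first by rewrite mxrank1 addn0.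
    by move=> x _; rewrite quadE lerDl mulmx_adj_ge0.
  (* On this kernel the two forms agree; its codimension is the rank of [Z], at most [n - d] because
     [A *m Z = 0]. *)
  apply: (@weyl _ _ _ _ _ _ _ _ (kermx (Z^t* )) Gh G0h).
    rewrite mxrank_ker mxrank_map mxrank_tr.
    have := mulmx0_rank_max AZ; move: Afree => /eqP ->.
    move: (\rank Z) => r; lia.
  by move=> x /sub_kermxP xZ; rewrite quadE xZ mul0mx [X in _ + X]mxE addr0.
pose N := kermx (A^t* ).
have rkN : (\rank N = n - d)%N.
  by rewrite mxrank_ker mxrank_map mxrank_tr; move: Afree => /eqP ->.
(* The [n - d] rows of [K] are orthonormal and killed by the adjoint of [A]. Multiplying by [K^t*]
   thus moves an arbitrary [Z] with [n - d] rows into the kernel of [A] without changing its Gram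
   matrix. *)
pose K := schmidt (row_base N).
have Ku : K \is unitarymx by rewrite schmidt_unitarymx// rank_leq_col.
have KA : K *m A^t* = 0.
  by apply/sub_kermxP; rewrite eqmx_schmidt_free ?row_base_free// eq_row_base.
rewrite -rkN in le_mu_lam.
have [Z Zh] := rank_perturbation G0h mu_ni mu0 le_lam_mu le_mu_lam.
have AZ : A *m (K^t* *m Z) = 0.
  by rewrite mulmxA -[A *m K^t*]trmxCK adjmxM trmxCK KA trmx0 map_mx0 mul0mx.
exists (G0 + K^t* *m Z); first by rewrite mulmxDr AZ addr0.
by rewrite cross// (adjmxM (K^t* ) Z) trmxCK mulmxA mulmxtVK.
Qed.

End MatrixDuals.

(** * Sequences in an inner product space *)

Section Synthesis.
Variables (K : fieldType) (E : lmodType K).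

Lemma synthesis_linear n (F : 'I_n -> E) : linear (synthesis F).
Proof.
move=> a x y; rewrite /synthesis scaler_sumr -big_split /=.
by apply: eq_bigr => i _; rewrite !mxE scalerDl scalerA.
Qed.

Lemma synthesis0 n (F : 'I_n -> E) : synthesis F 0 = 0.
Proof. by rewrite /synthesis big1// => i _; rewrite mxE scale0r. Qed.

Lemma synthesisZ n (F : 'I_n -> E) a x :
  synthesis F (a *: x) = a *: synthesis F x.
Proof. by rewrite -[a *: x]addr0 synthesis_linear synthesis0 addr0. Qed.

Lemma synthesis_delta n (F : 'I_n -> E) i : synthesis F (delta_mx 0 i) = F i.
Proof.
rewrite /synthesis (bigD1 i)//= mxE !eqxx scale1r big1 ?addr0// => j ji.
by rewrite mxE (negPf ji) andbF scale0r.
Qed.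

Lemma synthesis_mulmx m n (F : 'I_n -> E) (M : 'M[K]_(m, n)) (a : 'rV[K]_m) :
  synthesis F (a *m M) = synthesis (fun i => synthesis F (row i M)) a.
Proof.
rewrite /synthesis; under [RHS]eq_bigr do rewrite scaler_sumr.
rewrite exchange_big /=; apply: eq_bigr => j _; rewrite mxE scaler_suml.
by apply: eq_bigr => i _; rewrite mxE scalerA.
Qed.

Lemma eq_synthesis n (F G : 'I_n -> E) a : F =1 G ->
  synthesis F a = synthesis G a.
Proof. by move=> FG; apply: eq_bigr => i _; rewrite FG. Qed.

Lemma linear_synthesis n (F : 'I_n -> E) (P : E -> E) a : linear P ->
  P (synthesis F a) = synthesis (P \o F) a.
Proof.
move=> Plin.
have PD x y : P (x + y) = P x + P y by have := Plin 1 x y; rewrite !scale1r.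
have P0 : P 0 = 0 by apply: (addrI (P 0)); rewrite -PD !addr0.
have PZ b x : P (b *: x) = b *: P x by rewrite -[b *: x]addr0 Plin P0 addr0.
by rewrite /synthesis (big_morph P PD P0); apply: eq_bigr => i _; rewrite PZ.
Qed.

Lemma span_seq_mem n (F : 'I_n -> E) i : span_seq F (F i).
Proof. by exists (delta_mx 0 i) => //; rewrite synthesis_delta. Qed.

(** The coordinates of [b] with respect to [c] form a row-free matrix of size [m] by [n]. *)
Lemma lin_indep_leq m n (b : 'I_m -> E) (c : 'I_n -> E) :
  lin_indep b -> (forall i, span_seq c (b i)) -> (m <= n)%N.
Proof.
move=> b_free bc.
have /choice[f fE] i : exists x, synthesis c x = b i.
  by have [x _ xE] := bc i; exists x.
have /eqP <- : row_free (\matrix_i f i); last exact: rank_leq_col.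
apply: inj_row_free => v v0; apply: b_free.
rewrite -(synthesis0 c) -v0 synthesis_mulmx.
by apply: eq_synthesis => i; rewrite rowK fE.
Qed.

Lemma subspace_of_dim_uniq (U : set E) m n :
  subspace_of_dim U m -> subspace_of_dim U n -> m = n.
Proof.
move=> [b [b_free bU]] [c [c_free cU]]; apply/eqP; rewrite eqn_leq.
apply/andP; split.
  apply: (lin_indep_leq (c := c) b_free) => i.
  by rewrite cU -bU; apply: span_seq_mem.
apply: (lin_indep_leq (c := b) c_free) => i.
by rewrite bU -cU; apply: span_seq_mem.
Qed.

End Synthesis.

(** * Inner products and orthonormal bases *)

Section Coordinates.
Variables (R : realType) (H : lmodType R[i]) (dot : {dot H for Num.conj}).
Local Notation C := R[i].

Lemma dotC x y : dot x y = Num.conj (dot y x).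
Proof. by rewrite hermC expr0 mul1r. Qed.

Lemma dot_eq0 x : dot x x = 0 -> x = 0.
Proof. by move=> /eqP; rewrite dnorm_eq0 => /eqP. Qed.

Lemma dot_synthesisl n (F : 'I_n -> H) a y :
  dot (synthesis F a) y = \sum_i a 0 i * dot (F i) y.
Proof.
rewrite /synthesis linear_sumlz; apply: eq_bigr => i _.
by rewrite linearZl_LR.
Qed.

Lemma dot_synthesisr n (F : 'I_n -> H) a x :
  dot x (synthesis F a) = (analysis dot F x *m a^t*) 0 0.
Proof.
rewrite /synthesis linear_sumr mxE; apply: eq_bigr => i _.
by rewrite linearZr_LR /= !mxE mulrC.
Qed.

Lemma analysis_linear n (F : 'I_n -> H) : linear (analysis dot F).
Proof.
move=> a x y; apply/rowP => i; rewrite !mxE linearDl; congr (_ + _).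
by rewrite linearZl_LR.
Qed.

Definition orthonormal_seq n (e : 'I_n -> H) : Prop :=
  forall i j, dot (e i) (e j) = (i == j)%:R.

Lemma orthonormal_analysis n (e : 'I_n -> H) x : orthonormal_seq e ->
  analysis dot e (synthesis e x) = x.
Proof.
move=> eo; apply/rowP => j; rewrite mxE dot_synthesisl (bigD1 j)//= eo eqxx.
rewrite mulr1 big1 ?addr0// => i ij.
by rewrite eo (negPf ij) mulr0.
Qed.

Lemma orthonormal_inj n (e : 'I_n -> H) : orthonormal_seq e ->
  injective (synthesis e).
Proof. by move=> eo; apply: (can_inj (fun x => orthonormal_analysis x eo)). Qed.

Lemma orthonormal_lin_indep n (e : 'I_n -> H) :
  orthonormal_seq e -> lin_indep e.
Proof.
by move=> eo a a0; apply: (orthonormal_inj eo); rewrite a0 synthesis0.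
Qed.

(** The Gram matrix [N] of a basis is positive semidefinite and invertible. A matrix [E] that
    reduces it to the identity transforms the basis into an orthonormal one, with the same span
    since [E] is invertible. *)
Lemma orthonormal_basis (U : set H) k : subspace_of_dim U k ->
  exists2 e : 'I_k -> H, orthonormal_seq e & span_seq e = U.
Proof.
move=> [b [b_free bU]].
pose N : 'M[C]_k := \matrix_(i, j) dot (b i) (b j).
have dotE x y : dot (synthesis b x) (synthesis b y) = (x *m N *m y^t*) 0 0.
  rewrite dot_synthesisr; congr ((_ *m _) 0 0); apply/rowP => j.
  by rewrite !mxE dot_synthesisl; apply: eq_bigr => i _; rewrite !mxE.
have [||lam Nh] := @psd_has_spectrum R k N.
- by apply/matrixP => i j; rewrite !mxE [RHS]dotC.
- by move=> x; rewrite -dotE dnorm_ge0.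
have Nu : N \in unitmx.
  rewrite -row_free_unit; apply: inj_row_free => v vN; apply: b_free.
  by apply: dot_eq0; rewrite dotE vN mul0mx mxE.
have [E EN] := orthonormalize_gram Nh Nu.
have Eu : E \in unitmx by rewrite -mulmxA in EN; have [] := mulmx1_unit EN.
exists (fun i => synthesis b (row i E)).
  move=> i j; rewrite dotE -row_mul.
  have /matrixP/(_ i j) := EN; rewrite !mxE => <-.
  by apply: eq_bigr => l _; rewrite !mxE.
rewrite -bU; apply/seteqP; split => _ [x _ <-].
  by exists (x *m E) => //; rewrite synthesis_mulmx.
by exists (x *m invmx E) => //; rewrite -synthesis_mulmx mulmxKV.
Qed.

End Coordinates.

(** * Frame operators and eigenvalue lists in coordinates *)

Section FrameCoordinates.
Variables (R : realType) (H : lmodType R[i]) (dot : {dot H for Num.conj}).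
Local Notation C := R[i].

Definition seq_of_mx n d (e : 'I_d -> H) (M : 'M[C]_(n, d)) : 'I_n -> H :=
  fun i => synthesis e (row i M).

Lemma seq_of_mx_ex n d (e : 'I_d -> H) (G : 'I_n -> H) :
  (forall i, span_seq e (G i)) -> exists M, G = seq_of_mx e M.
Proof.
move=> eG; have /choice[f fE] i : exists x, synthesis e x = G i.
  by have [x _ xE] := eG i; exists x.
exists (\matrix_i f i); apply/funext => i.
by rewrite /seq_of_mx rowK fE.
Qed.

Lemma analysis_seq_of_mx n d (e : 'I_d -> H) (M : 'M[C]_(n, d)) f :
  analysis dot (seq_of_mx e M) f = analysis dot e f *m M^t*.
Proof.
apply/rowP => i; rewrite mxE dot_synthesisr !mxE.
by apply: eq_bigr => j _; rewrite !mxE.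
Qed.

Lemma frame_op_seq_of_mx n d (e : 'I_d -> H) (M : 'M[C]_(n, d)) f :
  frame_op dot (seq_of_mx e M) f =
  synthesis e (analysis dot e f *m (M^t* *m M)).
Proof. by rewrite /frame_op analysis_seq_of_mx mulmxA [RHS]synthesis_mulmx. Qed.

(** The length [r] is a dimension, and so is the multiplicity of each positive value; no other value
    occurs below [r]. Sorted lists with equal multiplicities coincide. *)
Lemma is_frame_eigenlist_uniq n (G : 'I_n -> H) lam lam' :
  is_frame_eigenlist dot G lam -> is_frame_eigenlist dot G lam' -> lam =1 lam'.
Proof.
move=> [r [rG ni pos out mult]] [r' [rG' ni' pos' out' mult']].
have rr := subspace_of_dim_uniq rG rG'; subst r'.
have cntE (l : nat -> R) c :
    count_mem c (mkseq l r) = #|[pred i : 'I_r | l i == c]|.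
  rewrite cardE size_filter /mkseq count_map -val_enum_ord count_map enumT.
  by apply: eq_count => i.
have cnt0 (l : nat -> R) (c : R) : (forall i, (i < r)%N -> 0 < l i) ->
    ~~ (0 < c) -> count_mem c (mkseq l r) = 0%N.
  move=> l_pos; apply: contraNeq; rewrite -lt0n -has_count has_pred1.
  case/(@mapP nat R) => i; rewrite mem_iota => /andP[_ /l_pos li] ->.
  exact: li.
have pm : perm_eq (mkseq lam r) (mkseq lam' r).
  apply/allP => c _ /=; apply/eqP; have [c0|c0] := boolP (0 < c); last first.
    by rewrite !cnt0.
  by rewrite !cntE; apply: subspace_of_dim_uniq (mult c c0) (mult' c c0).
move=> i; have [ri|ir] := leqP r i; first by rewrite out ?out'.
by apply: perm_mkseq_nonincreasing pm i ir => j k; [apply: ni|apply: ni'].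
Qed.

Lemma frame_eigenlistE n (G : 'I_n -> H) lam :
  is_frame_eigenlist dot G lam -> frame_eigenlist dot G =1 lam.
Proof.
move=> h; apply: is_frame_eigenlist_uniq (h).
exact: (xgetPex (fun=> 0) (ex_intro _ lam h)).
Qed.

(** As [c] is nonzero, an eigenvector [f] equals [S f] divided by [c], hence lies in the span of
    [e]. There the eigenspace is that of [B], with basis the rows of [U] whose eigenvalue is [c]. *)
Lemma eigenspace_dim d (S : H -> H) (e : 'I_d -> H) (B : 'M[C]_d) lam (c : R) :
    orthonormal_seq dot e ->
    (forall f, S f = synthesis e (analysis dot e f *m B)) ->
    has_spectrum B lam -> c != 0 ->
  subspace_of_dim (eigenspace_of S c) #|[pred i : 'I_d | lam i == c]|.
Proof.
move=> eo SE [_ _ [U Uu BE]] c_neq0.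
set I := [pred i : 'I_d | lam i == c].
pose W := rowsub (fun j : 'I_#|I| => enum_val j) U.
have WE a : synthesis e (a *m W) = synthesis (seq_of_mx e W) a.
  by rewrite synthesis_mulmx.
have UB : U *m B = diagC d lam *m U.
  by rewrite BE !mulmxA (unitarymxP Uu) mul1mx.
have WB : W *m B = c%:C *: W.
  apply/row_matrixP => j; rewrite linearZ /= row_mul !row_rowsub -row_mul UB.
  rewrite row_mul row_diag_mx -scalemxAl -rowE mxE; congr (_%:C *: _).
  by have /eqP := enum_valP j.
have Wu : W \is unitarymx.
  apply/unitarymxP/matrixP => i j.
  have /matrixP/(_ (enum_val i) (enum_val j)) := unitarymxP Uu; rewrite !mxE.
  rewrite (inj_eq enum_val_inj) => <-; apply: eq_bigr => k _.
  by rewrite !mxE.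
exists (seq_of_mx e W); split.
  move=> a; rewrite -WE -(synthesis0 e) => /(orthonormal_inj eo) aW.
  by rewrite -[a]mulmx1 -(unitarymxP Wu) mulmxA aW mul0mx.
apply/seteqP; split=> [_ [a _ <-]|f].
  rewrite /eigenspace_of /= SE -WE orthonormal_analysis// -mulmxA WB.
  by rewrite -scalemxAr synthesisZ.
rewrite /eigenspace_of /= SE => fE.
pose y := c%:C^-1 *: (analysis dot e f *m B).
have cC_neq0 : c%:C != 0 :> C by apply: contra c_neq0 => /eqP/complexI ->.
have {}fE : f = synthesis e y.
  by rewrite /y synthesisZ fE scalerA mulVf// scale1r.
have yB : y *m B = c%:C *: y.
  by rewrite {2}/y scalerA mulfV// scale1r fE orthonormal_analysis.
(* Coordinates of [y] in the eigenbasis; they vanish wherever [lam i] differs from [c]. *)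
pose z := y *m U^t*.
have zD : z *m diagC d lam = c%:C *: z.
  rewrite /z scalemxAl -yB BE !mulmxA mulmxtVK//.
have z_out (i : 'I_d) : lam i != c -> z 0 i = 0.
  move=> ne; have /rowP/(_ i) := zD; rewrite mul_mx_diag !mxE mulrC => /eqP.
  rewrite -subr_eq0 -mulrBl mulf_eq0 -rmorphB /= => /orP[/eqP|/eqP//].
  rewrite -(rmorph0 (real_complex R)) => /complexI/eqP.
  by rewrite subr_eq0 (negPf ne).
exists (\row_j z 0 (enum_val j)) => //; rewrite -WE fE; congr synthesis.
have -> : y = z *m U by rewrite /z -mulmxA unitarymx_adjmul// mulmx1.
apply/rowP => k; rewrite !mxE [RHS](bigID I) /= [X in _ = _ + X]big1 ?addr0.
  rewrite (big_enum_val (fun i => z 0 i * U i k)).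
  by apply: eq_bigr => j _; rewrite !mxE.
by move=> i /z_out ->; rewrite mul0r.
Qed.

(** The left inverse [A] makes the sequence span all of [span_seq e], so [r = d], and makes the Gram
    matrix of [M] invertible, so the first [d] eigenvalues are positive. *)
Lemma is_frame_eigenlist_seq_of_mx n d (e : 'I_d -> H) (A : 'M[C]_(d, n))
    (M : 'M[C]_(n, d)) lam :
    orthonormal_seq dot e -> A *m M = 1%:M -> has_spectrum (M^t* *m M) lam ->
  is_frame_eigenlist dot (seq_of_mx e M) lam.
Proof.
move=> eo AM h; exists d; have [ni out _] := h; split=> //.
- exists e; split; first exact: orthonormal_lin_indep.
  apply/seteqP; split=> _ [x _ <-].
    by exists (x *m A) => //; rewrite -synthesis_mulmx -mulmxA AM mulmx1.
  by exists (x *m M) => //; rewrite synthesis_mulmx.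
- move=> i id; apply: (has_spectrum_gt0 h) => //.
  have : row_free (M^t* ).
    by apply/row_freeP; exists (A^t* ); rewrite -adjmxM AM adjmx1.
  by move=> /gram_unitmx; rewrite trmxCK.
- move=> c c0; apply: (eigenspace_dim eo) h _; last by rewrite gt_eqF.
  exact: frame_op_seq_of_mx.
Qed.

End FrameCoordinates.

(** * Oblique duals in coordinates *)

Section ObliqueDuals.
Variables (R : realType) (H : lmodType R[i]) (dot : {dot H for Num.conj}).
Local Notation C := R[i].

Lemma linear_mulmx_synthesis d (e : 'I_d -> H) n (F : 'I_n -> H)
    (N : 'M[C]_(n, d)) :
  linear (fun f => synthesis e (analysis dot F f *m N)).
Proof.
by move=> a x y; rewrite analysis_linear mulmxDl -scalemxAl synthesis_linear.
Qed.

(** In an orthonormal basis of [W] the frame operator is an invertible matrix [N]. Its inverse,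
    extended by zero on the orthogonal complement of [W], solves the Penrose equations. *)
Lemma pinv_frame_op (W : set H) d n (F : 'I_n -> H) :
  subspace_of_dim W d -> is_frame W F ->
  is_pinv dot (frame_op dot F) (Defs.pinv dot (frame_op dot F)).
Proof.
move=> /(orthonormal_basis dot)[e eo eW] [FW spanF].
have [i|M FE] := @seq_of_mx_ex R H n d e F; first by rewrite eW.
have [A AM] : exists A : 'M[C]_(d, n), A *m M = 1%:M.
  have /choice[f fE] i : exists x, synthesis F x = e i.
    have : span_seq F (e i) by rewrite spanF -eW; apply: span_seq_mem.
    by case=> x _ xE; exists x.
  exists (\matrix_i f i); apply/row_matrixP => i; rewrite row_mul rowK row1.
  apply: (orthonormal_inj eo).
  rewrite synthesis_mulmx -[synthesis _ _]/(synthesis (seq_of_mx e M) _).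
  by rewrite -FE fE synthesis_delta.
have Nu : M^t* *m M \in unitmx.
  have : row_free (M^t* ).
    by apply/row_freeP; exists (A^t* ); rewrite -adjmxM AM adjmx1.
  by move=> /gram_unitmx; rewrite trmxCK.
set N := M^t* *m M in Nu.
have SE f : frame_op dot F f = synthesis e (analysis dot e f *m N).
  by rewrite FE frame_op_seq_of_mx.
pose X f := synthesis e (analysis dot e f *m invmx N).
(* This is the orthogonal projection onto [W], to which both compositions in the last two Penrose
   equations reduce. *)
have proj_adj : self_adjoint dot (fun f => synthesis e (analysis dot e f)).
  move=> x y; rewrite dot_synthesisr [LHS]dotC dot_synthesisr.
  rewrite mulmx_adjE [RHS]mulmx_adjE rmorph_sum; apply: eq_bigr => i _.
  by rewrite rmorphM mulrC; congr (_ * _); apply: conjCK.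
apply: (xgetPex (fun=> 0)); exists X; split.
- exact: linear_mulmx_synthesis.
- apply/funext => f; rewrite /= /X !SE !orthonormal_analysis//.
  by rewrite mulmxK.
- apply/funext => f; rewrite /= /X !SE !orthonormal_analysis//.
  by rewrite mulmxKV.
- move=> x y; rewrite /= /X !SE !orthonormal_analysis// !mulmxKV//.
- move=> x y; rewrite /= /X !SE !orthonormal_analysis// !mulmxK//.
Qed.

Definition analysis_mx d n (e : 'I_d -> H) (F : 'I_n -> H) : 'M[C]_(d, n) :=
  \matrix_i analysis dot F (e i).

Lemma analysis_synthesis d n (e : 'I_d -> H) (F : 'I_n -> H) y :
  analysis dot F (synthesis e y) = y *m analysis_mx e F.
Proof.
apply/rowP => j; rewrite !mxE dot_synthesisl; apply: eq_bigr => i _.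
by rewrite !mxE.
Qed.

(** By linearity, reconstruction on [V] amounts to reconstruction of each [e k], which is row [k] of
    the matrix identity. *)
Lemma oblique_dualE (V : set H) d (e : 'I_d -> H) n (F : 'I_n -> H)
    (M : 'M[C]_(n, d)) : orthonormal_seq dot e -> span_seq e = V ->
  oblique_dual dot V F (seq_of_mx e M) <-> analysis_mx e F *m M = 1%:M.
Proof.
move=> eo eV; have synthE g : \sum_(i < n) dot g (F i) *: seq_of_mx e M i =
    synthesis e (analysis dot F g *m M).
  by rewrite synthesis_mulmx; apply: eq_bigr => i _; rewrite mxE.
split=> [[_ dualG]|AM].
  apply/row_matrixP => k; rewrite row_mul rowK row1.
  apply: (orthonormal_inj eo); rewrite -synthE -dualG ?synthesis_delta//.
  by rewrite -eV; apply: span_seq_mem.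
split=> [i|g]; first by rewrite -eV; exists (row i M).
rewrite -eV => -[y _ <-].
by rewrite synthE analysis_synthesis -mulmxA AM mulmx1.
Qed.

Section Compatible.
Variables (V W : set H) (d n : nat) (e : 'I_d -> H) (F : 'I_n -> H).
Hypotheses (eo : orthonormal_seq dot e) (eV : span_seq e = V).
Hypotheses (WV : direct_sum (orthocomp dot W) V) (FW : is_frame W F).
Local Notation A := (analysis_mx e F).

Lemma orthocomp_analysis g : orthocomp dot W g <-> analysis dot F g = 0.
Proof.
have [FinW spanF] := FW; split=> [gW|Fg0].
  by apply/rowP => i; rewrite !mxE gW.
by move=> w; rewrite -spanF => -[a _ <-]; rewrite dot_synthesisr Fg0 mul0mx mxE.
Qed.

(** If [v *m A = 0], then [synthesis e v] lies both in [V] and in the orthogonal complement of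
    [W]. *)
Lemma analysis_mx_free : row_free A.
Proof.
apply: inj_row_free => v vA; apply: (orthonormal_inj eo); rewrite synthesis0.
have [_ /seteqP[sub0 _]] := WV; apply: (sub0); split.
  by apply/orthocomp_analysis; rewrite analysis_synthesis.
by rewrite -eV; exists v.
Qed.

Lemma oblique_projP (P := oblique_proj V (orthocomp dot W)) :
  [/\ linear P, forall x, P (P x) = P x,
      range P = V & P @^-1` [set 0] = orthocomp dot W].
Proof.
suff Qex : exists Q : H -> H, [/\ linear Q, forall x, Q (Q x) = Q x,
    range Q = V & Q @^-1` [set 0] = orthocomp dot W].
  exact: (xgetPex (fun=> 0) Qex).
pose G := A^t* *m invmx (A *m A^t* ).
have AG : A *m G = 1%:M.
  by rewrite mulmxA mulmxV// gram_unitmx// analysis_mx_free.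
(* Since [A *m G = 1%:M], [Q] is the identity on [V]; it kills whatever [analysis dot F] kills. *)
pose Q f := synthesis e (analysis dot F f *m G).
have QV v : V v -> Q v = v.
  by rewrite -eV => -[y _ <-]; rewrite /Q analysis_synthesis -mulmxA AG mulmx1.
have VQ f : V (Q f) by rewrite -eV; exists (analysis dot F f *m G).
have Q0 u : orthocomp dot W u -> Q u = 0.
  by move=> /orthocomp_analysis u0; rewrite /Q u0 mul0mx synthesis0.
have Qlin : linear Q by apply: linear_mulmx_synthesis.
exists Q; split=> //.
- by move=> x; apply/QV/VQ.
- by apply/seteqP; split=> [_ [x _ <-]//|v vV]; exists v => //; apply: QV.
- apply/seteqP; split=> [x /= Qx|x /Q0//].
  have [u [v [uW vV xE]]] := WV.1 x; move: Qx.
  rewrite xE -[u]scale1r Qlin Q0// scaler0 add0r QV// => ->.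
  by rewrite addr0 scale1r.
Qed.

(** Split [w] along the direct sum: both components are orthogonal to [w]. *)
Lemma orthocomp_trivial w : W w -> (forall v, V v -> dot w v = 0) -> w = 0.
Proof.
move=> wW wV; apply: (@dot_eq0 _ _ dot); have [u [v [uW vV wE]]] := WV.1 w.
have -> : dot w w = dot w u + dot w v by rewrite -linearDr -wE.
by rewrite (wV v vV) addr0 dotC uW// rmorph0.
Qed.

(** Two properties single out the matrix on the right: it is a right inverse of [A], and it is
    killed from the left by every row vector that kills [A^t*]. Both are checked for the matrix [M]
    of the canonical dual. *)
Lemma canonical_dualE : (exists k, subspace_of_dim W k) ->
  canonical_dual dot V W F = seq_of_mx e (A^t* *m invmx (A *m A^t* )).
Proof.
case=> k dimW; have [Xlin SXS _ _ _] := pinv_frame_op dimW FW.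
have [Plin _ rangeP kerP] := oblique_projP.
set P := oblique_proj _ _ in Plin rangeP kerP.
set X := Defs.pinv _ _ in Xlin SXS.
have [FinW spanF] := FW.
have [i|M GE] := @seq_of_mx_ex R H n d e (canonical_dual dot V W F).
  by rewrite eV -[V in V _]rangeP; exists (X (F i)).
have synthM a : synthesis e (a *m M) = P (X (synthesis F a)).
  rewrite synthesis_mulmx -[synthesis _ _]/(synthesis (seq_of_mx e M) _) -GE.
  by rewrite (linear_synthesis _ _ Xlin) (linear_synthesis _ _ Plin).
have AM : A *m M = 1%:M.
  apply/row_matrixP => j; rewrite row_mul rowK row1.
  apply: (orthonormal_inj eo); rewrite synthM synthesis_delta.
  rewrite -[synthesis _ _]/(frame_op dot F (e j)).
  have Pe : P (e j) = e j.
    have : range P (e j) by rewrite rangeP -eV; apply: span_seq_mem.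
    have [_ PP _ _] := oblique_projP.
    by move=> [x _ <-]; apply: PP.
  set S := frame_op dot F in SXS *.
  have Slin : linear S.
    by move=> a x y; rewrite /S /frame_op analysis_linear synthesis_linear.
  (* With [S X S = S], the vector [y] below lies in the kernel of [S], and [dot y (S y)] is the
     squared norm of [analysis dot F y]. So [y] is orthogonal to [W], the projection kills it, and
     the images of [X (S (e j))] and [e j] agree. *)
  suff : orthocomp dot W (-1 *: X (S (e j)) + e j).
    rewrite -kerP /= Plin Pe scaleN1r addrC => /eqP.
    by rewrite subr_eq0 => /eqP.
  set y := _ + _.
  have Sy : S y = 0.
    have := congr1 (fun f => f (e j)) SXS; rewrite /= => SXSe.
    by rewrite /y Slin SXSe scaleN1r addNr.
  have : dot y (S y) = 0 by rewrite Sy linear0r.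
  rewrite dot_synthesisr => /eqP; rewrite eq_le => /andP[Fy _].
  apply/orthocomp_analysis; apply/eqP; apply/negPn; rewrite -mulmx_adj_gt0.
  by apply/negP => /lt_le_trans/(_ Fy); rewrite ltxx.
(* Such an [a] synthesizes a vector of [W] orthogonal to [V], which is zero. *)
have kerM (a : 'rV[C]_n) : a *m A^t* = 0 -> a *m M = 0.
  move=> aA; apply: (orthonormal_inj eo); rewrite synthM synthesis0.
  suff -> : synthesis F a = 0.
    by rewrite -[in LHS](synthesis0 F) (linear_synthesis _ _ Xlin)
      (linear_synthesis _ _ Plin) synthesis0.
  apply: orthocomp_trivial; first by rewrite -spanF; exists a.
  move=> v; rewrite -eV => -[y _ <-]; rewrite dotC dot_synthesisr.
  rewrite analysis_synthesis -mulmxA.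
  have -> : A *m a^t* = 0.
    by rewrite -[LHS]trmxCK adjmxM trmxCK aA trmx0 map_mx0.
  by rewrite mulmx0 mxE rmorph0.
rewrite GE; congr seq_of_mx.
have Nu : A *m A^t* \in unitmx by rewrite gram_unitmx// analysis_mx_free.
(* Projection onto the row vectors that kill [A^t*]; expanding [Q *m M = 0] with [A *m M = 1%:M]
   yields the formula for [M]. *)
pose Q := 1%:M - A^t* *m invmx (A *m A^t* ) *m A.
have QA : Q *m A^t* = 0.
  by rewrite mulmxBl mul1mx -!mulmxA mulVmx// mulmx1 subrr.
have : Q *m M = 0.
  by apply/row_matrixP => i; rewrite row_mul row0 kerM// -row_mul QA row0.
by rewrite mulmxBl mul1mx -!mulmxA AM mulmx1 => /eqP; rewrite subr_eq0 => /eqP.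
Qed.

End Compatible.
End ObliqueDuals.

(** * From matrix spectra to eigenvalue lists of oblique duals *)

Lemma dim_index_lt (K : fieldType) (E : lmodType K) (U : set E) d i :
  subspace_of_dim U d -> (i < d)%N -> dim_index E i.
Proof.
move=> [b [b_free _]] id p [c [_ cT]]; apply: leq_trans id _.
by apply: (lin_indep_leq (c := c) b_free) => j; rewrite cT.
Qed.

Theorem theorem3p6 (R : realType) (H : completeNormedModType R[i])
    (dot : {dot H for Num.conj})
    (norm_dot : forall x : H, `|x| ^+ 2 = dot x x)
    (H_separable : separable_space H)
    (V W : set H) (d : nat)
    (dimV : subspace_of_dim V d) (dimW : subspace_of_dim W d)
    (WV : direct_sum (orthocomp dot W) V)
    (n : nat) (F : 'I_n -> H) (F_frame : is_frame W F)
    (mu : nat -> R) (mu_l1 : l1_plus_down (dim_index H) mu) :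
  let M := dim_index H in
  let lamsharp := frame_eigenlist dot (canonical_dual dot V W F) in
  let m : int := 2 * d%:Z - n%:Z in
  (exists G : 'I_n -> H,
     oblique_dual dot V F G /\
     forall i, M i -> frame_eigenlist dot G i = mu i)
  <->
  [/\ forall i, M i -> (d <= i)%N -> mu i = 0,
      m <= 0 -> forall i, (i < d)%N -> lamsharp i <= mu i &
      1 <= m ->
        (forall i, (i < d)%N -> lamsharp i <= mu i) /\
        (forall i k : nat, i%:Z < m -> k%:Z = d%:Z - m + i%:Z ->
           mu k <= lamsharp i)].
Proof.
move=> M lamsharp m.
have ltM i : (i < d)%N -> M i by apply: dim_index_lt dimV.
have [e eo eV] := orthonormal_basis dot dimV.
pose A := analysis_mx dot e F.
have Afree : row_free A := analysis_mx_free eo eV WV F_frame.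
have dn : (d <= n)%N by move/eqP: (Afree) => <-; apply: rank_leq_col.
pose G0 := A^t* *m invmx (A *m A^t* ).
have [lam lamh] := gram_has_spectrum G0.
have AG0 : A *m G0 = 1%:M by rewrite mulmxA mulmxV// gram_unitmx.
have [lam_ni lam0 _] := lamh.
have lamE : lamsharp =1 lam.
  apply: frame_eigenlistE; rewrite (canonical_dualE eo eV WV F_frame).
    exact: is_frame_eigenlist_seq_of_mx eo AG0 lamh.
  by exists d.
split=> [[G [dualG Gmu]]|[mu0 le_m_le0 le_m_gt0]].
  have [i|MG GE] := @seq_of_mx_ex R H n d e G; first by rewrite eV; apply dualG.
  rewrite GE in dualG Gmu; have AG := (oblique_dualE F MG eo eV).1 dualG.
  have [nu nuh] := gram_has_spectrum MG; have [nu_ni nu0 _] := nuh.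
  have nuE := frame_eigenlistE (is_frame_eigenlist_seq_of_mx eo AG nuh).
  have [|le_lam_nu le_nu_lam] := (dual_spectrum Afree lamh nu_ni nu0).1.
    by exists MG.
  have le_lam_mu i : (i < d)%N -> lamsharp i <= mu i.
    by move=> /ltM Mi; rewrite lamE -Gmu// nuE.
  split=> [i Mi di|_ //|m_gt0]; first by rewrite -Gmu// nuE nu0.
  split=> // i k im kE.
  (* With [m = 2 d - n], the offset [d - m] is [n - d], a natural number since [d <= n]; zero-based
     indices leave it unchanged. *)
  have -> : k = (i + (n - d))%N by rewrite /m in im kE; lia.
  by rewrite lamE -Gmu ?nuE//; apply: ltM; rewrite /m in im; lia.
have [mu_ge0 mu_ni _] := mu_l1.
have le_lam_mu i : (i < d)%N -> lam i <= mu i.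
  rewrite -lamE; have [/le_m_le0|m_gt0] := leP m 0; first exact.
  by have [|] := le_m_gt0; [lia | move=> + _; apply].
(* [mu] is controlled only on the index set [M], which may be finite, whereas a spectrum must vanish
   at every index from [d] on. *)
pose nu i := if (i < d)%N then mu i else 0.
have nu_ni i j : (i <= j)%N -> nu j <= nu i.
  rewrite /nu => ij; case: (ltnP j d) => [jd|dj].
    by rewrite (leq_ltn_trans ij jd) mu_ni//; apply: ltM => //;
      apply: leq_ltn_trans jd.
  by case: ifP => // /ltM Mi; apply: mu_ge0.
have nu0 i : (d <= i)%N -> nu i = 0 by rewrite /nu leqNgt => /negPf ->.
have [|MG AG nuh] := (dual_spectrum Afree lamh nu_ni nu0).2.
  split=> i; rewrite /nu.
    by case: ifP => [/le_lam_mu//|/negbT]; rewrite -leqNgt => /lam0 ->.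
  (* If [i + (n - d) < d], then [i < m], so [m] is positive and the upper bounds of case (b) apply;
     otherwise [nu] is zero there. *)
  case: ifP => [id|_]; last exact: has_spectrum_ge0 lamh.
  have [|_ +] := le_m_gt0; first by rewrite /m; lia.
  by rewrite -lamE; apply; rewrite /m; lia.
exists (seq_of_mx e MG); split; first by apply/(oblique_dualE F MG eo eV).
move=> i Mi.
rewrite (frame_eigenlistE (is_frame_eigenlist_seq_of_mx eo AG nuh)) /nu.
by case: ltnP => // di; rewrite mu0.
Qed.
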